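(* Let $\mathcal F$ be a maximal commuting family of $\mathbf i$-boxes in an interval $[a,b]$. Then for any $\mathfrak c=[x,y]\in\mathcal F$ there exists a unique $z\in\{x,y\}$ such that for any admissible chain $\mathfrak C=(\mathfrak c_k)_{1\le k\le l}$ of $\mathbf i$-boxes with extent $[a,b]$ consisting of $\mathbf i$-boxes in $\mathcal F$, if $\mathfrak c=\mathfrak c_k$ then $\{z\}=\widetilde{\mathfrak c}_k\setminus\widetilde{\mathfrak c}_{k-1}$.
   Context: Let $I$ be a set, $S\subset\mathbb Z$ an interval, $\mathbf i=(i_k)_{k\in S}$ a sequence in $I$, and $[a,b]=\{k\in\mathbb Z:a\le k\le b\}\subset S$ a finite nonempty interval. For $s\in S$, $j\in I$: $s_+=\min(\{t\in S:t>s,i_t=i_s\}\cup\{\infty\})$, $s_-=\max(\{t\in S:t<s,i_t=i_s\}\cup\{-\infty\})$, $s(j)^+=\min(\{t\in S:t\ge s,i_t=j\}\cup\{\infty\})$, $s(j)^-=\max(\{t\in S:t\le s,i_t=j\}\cup\{-\infty\})$. An $\mathbf i$-box is a finite interval $[x,y]\subset S$ with $i_x=i_y$ (its color). For an interval $[x,y]$: $[x,y\}=[x,y(i_x)^-]$, $\{x,y]=[x(i_y)^+,y]$. Two $\mathbf i$-boxes $[x_1,y_1],[x_2,y_2]$ commute if $(x_1)_-<x_2\le y_2<(y_1)_+$ or $(x_2)_-<x_1\le y_1<(y_2)_+$. A commuting family of $\mathbf i$-boxes in $[a,b]$ is a set of pairwise commuting $\mathbf i$-boxes contained in $[a,b]$;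 it is maximal if it is maximal among such families. An admissible chain of $\mathbf i$-boxes is a sequence $(\mathfrak c_k=[x_k,y_k])_{1\le k\le l}$ of $\mathbf i$-boxes ($l\ge1$) such that for each $k\in[1,l]$ the envelope $\widetilde{\mathfrak c}_k=[\tilde x_k,\tilde y_k]:=\bigcup_{1\le j\le k}[x_j,y_j]$ is an interval with $k$ elements, and either $[x_k,y_k]=[\tilde x_k,\tilde y_k\}$ or $[x_k,y_k]=\{\tilde x_k,\tilde y_k]$. Its extent is $\widetilde{\mathfrak c}_l$; by convention $\widetilde{\mathfrak c}_0=\emptyset$. (For every maximal commuting family $\mathcal F$ in $[a,b]$, at least one admissible chain with extent $[a,b]$ consisting of boxes of $\mathcal F$ exists, and its set of members is $\mathcal F$.) *)

(* Defs.v *)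
From mathcomp Require Import all_boot all_order all_algebra.
From mathcomp Require Import boolp classical_sets functions cardinality.
From mathcomp Require Import constructive_ereal num_normedtype.

Set Implicit Arguments.
Unset Strict Implicit.
Unset Printing Implicit Defensive.

Import Order.TTheory GRing.Theory Num.Theory.

Local Open Scope classical_set_scope.
Local Open Scope ring_scope.

(* emin and emax are only applied to sets that have a least, resp. greatest,
   element, so the default values are never used. *)
Definition emin (A : set (\bar int)) : \bar int := xget +oo%E (A `&` lbound A).
Definition emax (A : set (\bar int)) : \bar int := xget -oo%E (A `&` ubound A).

Definition eitv (p q : \bar int) : set int :=
  [set t | (p <= t%:E)%E /\ (t%:E <= q)%E].

Definition zitv (p q : int) : set int := eitv p%:E q%:E.

Section IBoxes.
(* The sequence (i_k)_{k in S} is given by a function on all of Z; its values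
   outside S are never used. *)
Variables (I : Type) (S : set int) (i : int -> I).

(* succ_color s, pred_color s, color_ge s j and color_le s j are s_+, s_-,
   s(j)^+ and s(j)^-, with \bar int as Z with -oo and +oo added. *)
Definition succ_color (s : int) : \bar int :=
  emin (EFin @` [set t | [/\ S t, s < t & i t = i s]] `|` [set +oo%E]).

Definition pred_color (s : int) : \bar int :=
  emax (EFin @` [set t | [/\ S t, t < s & i t = i s]] `|` [set -oo%E]).

Definition color_ge (s : int) (j : I) : \bar int :=
  emin (EFin @` [set t | [/\ S t, s <= t & i t = j]] `|` [set +oo%E]).

Definition color_le (s : int) (j : I) : \bar int :=
  emax (EFin @` [set t | [/\ S t, t <= s & i t = j]] `|` [set -oo%E]).

(* A nonempty finite interval [x, y] is represented by its pair (x, y) of end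
   points, which determines it and is determined by it. *)
Definition ibox (c : int * int) : Prop :=
  [/\ c.1 <= c.2, zitv c.1 c.2 `<=` S & i c.1 = i c.2].

(* [x, y} = [x, y(i_x)^-] and {x, y] = [x(i_y)^+, y] *)
Definition itv_lbox (x y : int) : set int := eitv x%:E (color_le y (i x)).
Definition itv_rbox (x y : int) : set int := eitv (color_ge x (i y)) y%:E.

Definition commute_boxes (c d : int * int) : Prop :=
  [/\ (pred_color c.1 < d.1%:E)%E, d.1 <= d.2 & (d.2%:E < succ_color c.2)%E] \/
  [/\ (pred_color d.1 < c.1%:E)%E, c.1 <= c.2 & (c.2%:E < succ_color d.2)%E].

Definition commuting_family (a b : int) (F : set (int * int)) : Prop :=
  [/\ forall c, F c -> ibox c,
      forall c, F c -> zitv c.1 c.2 `<=` zitv a b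
    & forall c d, F c -> F d -> commute_boxes c d].

Definition maximal_commuting_family (a b : int) (F : set (int * int)) : Prop :=
  commuting_family a b F /\
  forall G, commuting_family a b G -> F `<=` G -> G = F.

(* Chains are indexed from 1, and envelope c 0 is empty. *)
Definition envelope (c : nat -> int * int) (k : nat) : set int :=
  \bigcup_(j in [set j | (1 <= j <= k)%N]) zitv (c j).1 (c j).2.

(* Only the terms c 1, ..., c l of c are used. *)
Definition admissible_chain (l : nat) (c : nat -> int * int) : Prop :=
  (1 <= l)%N /\
  forall k : nat, (1 <= k <= l)%N ->
    ibox (c k) /\
    exists x y : int,
      [/\ envelope c k = zitv x y,
          (envelope c k #= `I_k)%card
        & zitv (c k).1 (c k).2 = itv_lbox x y \/
          zitv (c k).1 (c k).2 = itv_rbox x y].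

End IBoxes.

(* Main.v *)
Require Import Defs.
From mathcomp Require Import all_boot all_order all_algebra.
From mathcomp Require Import boolp classical_sets functions cardinality.
From mathcomp Require Import constructive_ereal num_normedtype.
From mathcomp Require Import reals zify.

Set Implicit Arguments.
Unset Strict Implicit.
Unset Printing Implicit Defensive.

Import Order.TTheory GRing.Theory Num.Theory.

Local Open Scope classical_set_scope.
Local Open Scope ring_scope.

(** The left (resp. right) end of a box [c] in [F] is the point that [c] adds
to a chain, and a criterion that mentions [F] alone decides which: [c = [x, y]]
adds [y] if [F] contains a shorter box starting at [x], and adds [x] otherwise.

In a chain each envelope has exactly one point more than the preceding one, so
that the new point is an end of the envelope; being covered by the new box, it
is also an end of that box ([chain_step]).

Suppose that [c = c_k] adds [x] and that [F] contains [[x, y']] with [y' < y].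
A chain with extent [[a, b]] uses all the boxes of [F] ([chain_complete]), so
[[x, y']] is some [c_j].  It does not come before [c], whose point [x] is still
new at step [k], and it does not come after [c], which already covers it.

Suppose that [c] adds [y] and that [x < y].  Then [x] is in the preceding
envelope, so it is an end of some earlier box [c_j] ([chain_endpoint]).  Since
[c] is [{u, v]] for the envelope [[u, v]], no point of [[u, v]] before [x] has
the color of [x]; hence [x] is the left end of [c_j], and [c_j] is shorter
than [c].

If [x <> y], the point is unique as soon as some chain of boxes of [F] with
extent [[a, b]] passes through [c].  Such a chain is built by adding the
largest boxes [[a, b}] and [{a, b]] last.  A box starting at [a] other than
[[a, b}] and a box ending at [b] other than [{a, b]] do not commute, so one of
the two ends of [[a, b]] meets a single possible box of [F]; the other boxes
lie in a shorter interval ([commuting_family_chain]).  The boxes of any chain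
commute, so by maximality this chain stays in [F]. *)

(** * Extrema of sets of integers *)

(** The infinite value joined to [A] is reached when [A] is empty; otherwise
boundedness of [A] provides the extremum. *)
Lemma emin_spec (A : set int) (m : int) : lbound A m ->
  let B := EFin @` A `|` [set +oo%E] in (B `&` lbound B) (emin B).
Proof.
move=> Am B; apply: xgetPex.
have [[t At]|/forallNP A0] := pselect (A !=set0).
  have [p [Ap pmin]] := int_lbound_has_minimum (ex_intro _ t At) Am.
  exists p%:E; split; first by left; exists p.
  by move=> _ [[s As <-]|->]; rewrite ?leey // lee_fin pmin.
exists +oo%E; split; first by right.
by move=> _ [[s /A0 //]|->].
Qed.

Lemma emax_spec (A : set int) (m : int) : ubound A m ->
  let B := EFin @` A `|` [set -oo%E] in (B `&` ubound B) (emax B).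
Proof.
move=> Am B; apply: xgetPex.
have [[t At]|/forallNP A0] := pselect (A !=set0).
  have [|p [[q Aq <-] qmax]] :=
    @int_lbound_has_minimum (-%R @` A) (- m)
      (ex_intro _ (- t) (ex_intro2 _ _ t At erefl)).
    by move=> _ [s /Am sm <-]; rewrite lerN2.
  exists q%:E; split; first by left; exists q.
  move=> _ [[s As <-]|->]; rewrite ?leNye // lee_fin -lerN2.
  by apply: qmax; exists s.
exists -oo%E; split; first by right.
by move=> _ [[s /A0 //]|->].
Qed.

Lemma lt_emin (A : set int) (m x : int) : lbound A m ->
  (x%:E < emin (EFin @` A `|` [set +oo]))%E <-> forall t, A t -> x < t.
Proof.
move=> /emin_spec [eA elb]; split=> [xe t At|xA].
  by rewrite -lte_fin; apply: lt_le_trans xe _; apply: elb; left; exists t.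
by case: eA => [[t At <-]|->]; rewrite ?ltey // lte_fin xA.
Qed.

Lemma emax_lt (A : set int) (m x : int) : ubound A m ->
  (emax (EFin @` A `|` [set -oo]) < x%:E)%E <-> forall t, A t -> t < x.
Proof.
move=> /emax_spec [eA eub]; split=> [xe t At|xA].
  by rewrite -lte_fin; apply: le_lt_trans xe; apply: eub; left; exists t.
by case: eA => [[t At <-]|->]; rewrite ?ltNye // lte_fin xA.
Qed.

(** * Intervals of integers *)

Lemma zitvE (p q t : int) : zitv p q t <-> p <= t <= q.
Proof.
rewrite /zitv /eitv /= !lee_fin; split=> [[-> ->]//|/andP//].
Qed.

Lemma zitv0 (p q : int) : q < p -> zitv p q = set0.
Proof. by move=> qp; apply/seteqP; split=> t // /zitvE; lia. Qed.

Lemma subset_zitv (p q u v : int) : p <= q ->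
  zitv p q `<=` zitv u v <-> u <= p /\ q <= v.
Proof.
move=> pq; split=> [sub|[up qv] t /zitvE pt]; last by apply/zitvE; lia.
have /sub/zitvE : zitv p q p by apply/zitvE; lia.
have /sub/zitvE : zitv p q q by apply/zitvE; lia.
by lia.
Qed.

Lemma zitv_inj (p q u v : int) : p <= q -> zitv p q = zitv u v -> u = p /\ v = q.
Proof.
move=> pq eq_pq.
have [up qv] : u <= p /\ q <= v by apply/subset_zitv => //; rewrite eq_pq.
have [pu vq] : p <= u /\ v <= q by apply/subset_zitv; [lia|rewrite eq_pq].
by lia.
Qed.

Lemma card_zitv (p q : int) (n : nat) :
  q = p + n%:Z - 1 -> (zitv p q #= `I_n)%card.
Proof.
move=> ->; have <- : (fun j : nat => p + j%:Z) @` `I_n = zitv p (p + n%:Z - 1).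
  apply/seteqP; split=> [_ [j /= jn <-]|t /zitvE pt]; first by apply/zitvE; lia.
  by exists (absz (t - p)) => /=; lia.
by apply: inj_card_eq => j k _ _; lia.
Qed.

Lemma card_zitv_inj (p q : int) (n : nat) : p <= q ->
  (zitv p q #= `I_n)%card -> q = p + n%:Z - 1.
Proof.
move=> pq /card_esym; have : q = p + (absz (q - p + 1))%:Z - 1 by lia.
by move=> /card_zitv /[swap] /card_eq_trans /[apply] /card_eq_II ->; lia.
Qed.

Lemma zitvD_first (u v : int) : u <= v -> zitv u v `\` zitv (u + 1) v = [set u].
Proof.
move=> uv; apply/seteqP; split=> [t [/zitvE tuv tuv'] /=|_ ->].
  by apply: contrapT => tu; apply/tuv'/zitvE; lia.
by split=> [|/zitvE]; [apply/zitvE|]; lia.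
Qed.

Lemma zitvD_last (u v : int) : u <= v -> zitv u v `\` zitv u (v - 1) = [set v].
Proof.
move=> uv; apply/seteqP; split=> [t [/zitvE tuv tuv'] /=|_ ->].
  by apply: contrapT => tv; apply/tuv'/zitvE; lia.
by split=> [|/zitvE]; [apply/zitvE|]; lia.
Qed.

(** * Boxes and commutation *)

Section Chains.
Variables (I : Type) (S : set int) (i : int -> I).

Implicit Types (c d : int * int) (u v p q s t : int) (C : nat -> int * int).

Lemma pred_color_lt s t :
  (pred_color S i s < t%:E)%E <-> forall r, S r -> r < s -> i r = i s -> r < t.
Proof.
rewrite /pred_color (@emax_lt _ s) => [|r [_ rs _]]; last exact: ltW.
by split=> H r; [move=> *; apply: H|move=> []; apply: H].
Qed.

Lemma succ_color_gt s t :
  (t%:E < succ_color S i s)%E <-> forall r, S r -> s < r -> i r = i s -> t < r.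
Proof.
rewrite /succ_color (@lt_emin _ s) => [|r [_ rs _]]; last exact: ltW.
by split=> H r; [move=> *; apply: H|move=> []; apply: H].
Qed.

(** For a box [c] and an interval [[u, v]] of [S], [left_box u v c] says that
[c] is [[u, v}], and [right_box u v c] that [c] is [{u, v]]. *)
Definition left_box u v c :=
  [/\ c.1 = u, u <= c.2 <= v, i c.2 = i u
    & forall t, c.2 < t <= v -> i t <> i u].

Definition right_box u v c :=
  [/\ c.2 = v, u <= c.1 <= v, i c.1 = i v
    & forall t, u <= t < c.1 -> i t <> i v].

Lemma color_le_max u v : u <= v -> zitv u v `<=` S ->
  exists q, color_le S i v (i u) = q%:E /\ left_box u v (u, q).
Proof.
move=> uv uvS; pose A := [set t | [/\ S t, t <= v & i t = i u]].
have Au : A u by split=> //; apply/uvS/zitvE; lia.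
have Av : ubound A v by move=> t [].
have [eA eub] := emax_spec Av.
rewrite /color_le -/A; set e := emax _ in eA eub *.
have uq : (u%:E <= e)%E by apply: eub; left; exists u.
case: eA uq eub => [[q [Sq qv iq] <-]|-> //]; rewrite lee_fin => uq eub.
exists q; split=> //; split=> //=; rewrite ?uq // => t qtv it.
have : (t%:E <= q%:E)%E.
  by apply: eub; left; exists t => //; split=> //; [apply/uvS/zitvE|]; lia.
by rewrite lee_fin; lia.
Qed.

Lemma color_ge_min u v : u <= v -> zitv u v `<=` S ->
  exists p, color_ge S i u (i v) = p%:E /\ right_box u v (p, v).
Proof.
move=> uv uvS; pose A := [set t | [/\ S t, u <= t & i t = i v]].
have Av : A v by split=> //; apply/uvS/zitvE; lia.
have Au : lbound A u by move=> t [].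
have [eA elb] := emin_spec Au.
rewrite /color_ge -/A; set e := emin _ in eA elb *.
have pv : (e <= v%:E)%E by apply: elb; left; exists v.
case: eA pv elb => [[p [Sp up ip] <-]|-> //]; rewrite lee_fin => pv elb.
exists p; split=> //; split=> //=; rewrite ?up // => t utp it.
have : (p%:E <= t%:E)%E.
  by apply: elb; left; exists t => //; split=> //; [apply/uvS/zitvE|]; lia.
by rewrite lee_fin; lia.
Qed.

Lemma itv_lboxE u v c : u <= v -> zitv u v `<=` S -> c.1 <= c.2 ->
  zitv c.1 c.2 = itv_lbox S i u v <-> left_box u v c.
Proof.
move=> uv uvS c12; have [q [eq_q [_ /= qv iq qmax]]] := color_le_max uv uvS.
rewrite /itv_lbox eq_q -/(zitv u q); split=> [/(zitv_inj c12) [uE qE]|].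
  by rewrite /left_box -uE -qE.
move=> [c1u c2v ic2 c2max]; congr zitv => //.
have [c2q|qc2|//] := ltgtP c.2 q; first by case: (c2max q) => //; lia.
by case: (qmax c.2) => //; lia.
Qed.

Lemma itv_rboxE u v c : u <= v -> zitv u v `<=` S -> c.1 <= c.2 ->
  zitv c.1 c.2 = itv_rbox S i u v <-> right_box u v c.
Proof.
move=> uv uvS c12; have [p [eq_p [_ /= up ip pmin]]] := color_ge_min uv uvS.
rewrite /itv_rbox eq_p -/(zitv p v); split=> [/(zitv_inj c12) [pE vE]|].
  by rewrite /right_box -pE -vE.
move=> [c2v c1u ic1 c1min]; congr zitv => //.
have [c1p|pc1|//] := ltgtP c.1 p; first by case: (pmin c.1) => //; lia.
by case: (c1min p) => //; lia.
Qed.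

(** Unfolding [s_+] and [s_-] into statements about all points of a color keeps
the order on extended integers out of the arguments below. *)
Lemma commute_boxesE c d : c.1 <= c.2 -> d.1 <= d.2 ->
  commute_boxes S i c d <->
  ((forall t, S t -> t < c.1 -> i t = i c.1 -> t < d.1) /\
   (forall t, S t -> c.2 < t -> i t = i c.2 -> d.2 < t)) \/
  ((forall t, S t -> t < d.1 -> i t = i d.1 -> t < c.1) /\
   (forall t, S t -> d.2 < t -> i t = i d.2 -> c.2 < t)).
Proof.
move=> c12 d12; rewrite /commute_boxes -!pred_color_lt -!succ_color_gt.
by split=> [[[]|[]]|[[]|[]]]; [left|right|left|right].
Qed.

Lemma commute_boxes_sym c d : commute_boxes S i c d -> commute_boxes S i d c.
Proof. by case; [right|left]. Qed.

(** The next point of the color of [u] after [[u, v}] is beyond [v], and the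
previous one is before [u], so every box inside [[u, v]] is enclosed. *)
Lemma left_box_commute u v c d : left_box u v c -> zitv u v `<=` S ->
   d.1 <= d.2 -> u <= d.1 -> d.2 <= v -> commute_boxes S i c d.
Proof.
move=> [c1 c2 ic cmax] uvS d12 ud dv; apply/commute_boxesE => //; first lia.
left; split=> t St; rewrite ?c1 => ct it; first lia.
by rewrite ltNge; apply/negP => td; case: (cmax t); [lia|rewrite it].
Qed.

Lemma right_box_commute u v c d : right_box u v c -> zitv u v `<=` S ->
   d.1 <= d.2 -> u <= d.1 -> d.2 <= v -> commute_boxes S i c d.
Proof.
move=> [c2 c1 ic cmin] uvS d12 ud dv; apply/commute_boxesE => //; first lia.
left; split=> t St; rewrite ?c2 => ct it; last lia.
by rewrite ltNge; apply/negP => td; case: (cmin t); [lia|rewrite it].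
Qed.

(** * The steps of an admissible chain *)

Lemma envelope0 C : envelope C 0 = set0.
Proof. by apply/seteqP; split=> t // [j /=]; lia. Qed.

Lemma envelopeS C k : envelope C k.+1 = envelope C k `|` zitv (C k.+1).1 (C k.+1).2.
Proof.
apply/seteqP; split=> [t [j /= jk tj]|t [[j /= jk tj]|tk]].
- have [jE|jneq] := eqVneq j k.+1; [by right; rewrite -jE|].
  by left; exists j => //=; lia.
- by exists j => //=; lia.
- by exists k.+1 => //=; lia.
Qed.

Lemma sub_envelope C j k : (1 <= j <= k)%N -> zitv (C j).1 (C j).2 `<=` envelope C k.
Proof. by move=> jk t tj; exists j. Qed.

Lemma envelope_mono C j k : (j <= k)%N -> envelope C j `<=` envelope C k.
Proof. by move=> jk t [r /= rj tr]; exists r => //=; lia. Qed.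

Lemma eq_envelope C D k : (forall j, (1 <= j <= k)%N -> C j = D j) ->
  envelope C k = envelope D k.
Proof.
by move=> CD; apply/seteqP; split=> t [j jk tj]; exists j => //;
  [rewrite -CD|rewrite CD].
Qed.

Section Chain.
Variables (l : nat) (C : nat -> int * int).
Hypothesis chainC : admissible_chain S i l C.

Lemma chain_ibox k : (1 <= k <= l)%N -> ibox S i (C k).
Proof. by case: chainC => _ H /H []. Qed.

Lemma chain_itv k : (1 <= k <= l)%N -> exists u v,
  [/\ envelope C k = zitv u v, v = u + k%:Z - 1, zitv u v `<=` S &
      left_box u v (C k) \/ right_box u v (C k)].
Proof.
move=> kl; case: chainC => _ /(_ k kl) [[c12 _ _] [u [v [envk cardk ck]]]].
have envS : envelope C k `<=` S.
  by move=> t [j /= jk tj]; case: (@chain_ibox j) => [|_ + _]; [lia|apply].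
have uv : u <= v.
  have [//|vu] := leP u v; have : envelope C k (C k).1.
    by exists k => /=; [lia|apply/zitvE; lia].
  by rewrite envk zitv0.
rewrite envk in cardk envS; exists u, v; split=> //.
  exact: card_zitv_inj.
by case: ck => ck; [left; apply/itv_lboxE|right; apply/itv_rboxE].
Qed.

(** The point missing from the preceding envelope is [u] or [v].  A new box
[{u, v]] that adds [u] has to contain [u]; then it is the whole of [[u, v]],
and so it is [[u, v}] as well. *)
Lemma chain_step k : (1 <= k <= l)%N -> exists u v,
  [/\ u <= v, envelope C k = zitv u v &
      (left_box u v (C k) /\ envelope C k.-1 = zitv (u + 1) v) \/
      (right_box u v (C k) /\ envelope C k.-1 = zitv u (v - 1))].
Proof.
case: k => // k kl; have [u [v [envk vE uvS ck]]] := chain_itv kl.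
exists u, v; split=> //; first lia.
have [k0|k_gt0] := posnP k.
  (* Here u = v is both the left and the right end. *)
  subst k; have vu : v = u by lia.
  rewrite /= envelope0 zitv0; last lia.
  case: ck => ck; [left|right]; split=> //.
  by rewrite zitv0 //; lia.
have [|u' [v' [envk' v'E _ _]]] := @chain_itv k; first lia.
have [uu' v'v] : u <= u' /\ v' <= v.
  apply/subset_zitv; first lia.
  by rewrite -envk -envk'; apply: envelope_mono; lia.
move: envk; rewrite envelopeS envk' /= => envk.
(* The preceding envelope is one point shorter. *)
have [u'E|u'E] : u' = u + 1 \/ u' = u by lia.
  left; split; last by rewrite u'E; congr zitv; lia.
  case: ck => // -[c2 c1 ic cmin].
  have : zitv u v u by apply/zitvE; lia.
  rewrite -envk => -[/zitvE|/zitvE]; first lia.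
  move=> cu; have c1u : (C k.+1).1 = u by lia.
  split=> //; [lia|by rewrite c2 -ic c1u|lia].
right; split; last by rewrite u'E; congr zitv; lia.
case: ck => // -[c1 c2 ic cmax].
have : zitv u v v by apply/zitvE; lia.
rewrite -envk => -[/zitvE|/zitvE]; first lia.
move=> cv; have c2v : (C k.+1).2 = v by lia.
split=> //; [lia|by rewrite c1 -ic c2v|lia].
Qed.

Lemma chain_new_point k : (1 <= k <= l)%N ->
  ~ zitv (C k).1 (C k).2 `<=` envelope C k.-1.
Proof.
move=> /chain_step [u [v [uv envk [[[c1 c2 _ _] ->]|[[c2 c1 _ _] ->]]]]].
  by move=> /subset_zitv; lia.
by move=> /subset_zitv; lia.
Qed.

(** At the first step whose envelope contains it, a point is new, hence an end
of the box of that step. *)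
Lemma chain_endpoint k t : (k <= l)%N -> envelope C k t ->
  exists2 j, (1 <= j <= k)%N & t = (C j).1 \/ t = (C j).2.
Proof.
elim: k => [|k IH] kl; first by rewrite envelope0.
have [tk _|tk envt] := pselect (envelope C k t).
  by have [|j jk tj] := IH _ tk; [lia|exists j => //; lia].
exists k.+1; first lia.
have [|u [v [uv envk Ck]]] := @chain_step k.+1; first lia.
move: envt; rewrite envk => /zitvE tuv.
case: Ck => -[[c _ _ _]] /= envk'; rewrite envk' zitvE in tk; lia.
Qed.

(** A chain is maximal among the commuting families in its extent.  Let [k]
be the first step whose envelope [[u, v]] contains [d], and let the new point
be [u]; then [d] starts at [u], like [c_k].  If [d] ended before [c_k], the
right end of [c_k], of color [i u], would be an end of an earlier box [c_j].
This [c_j] does not contain [u] but reaches beyond [d], and it has the color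
of [d]: each of the two boxes stops the other, so they do not commute. *)
Lemma chain_complete d : ibox S i d -> zitv d.1 d.2 `<=` envelope C l ->
  (forall k, (1 <= k <= l)%N -> commute_boxes S i d (C k)) ->
  exists2 k, (1 <= k <= l)%N & C k = d.
Proof.
move=> [d12 dS id] dl dC.
have Sd1 : S d.1 by apply/dS/zitvE; lia.
have Sd2 : S d.2 by apply/dS/zitvE; lia.
suff : forall k, (k <= l)%N -> zitv d.1 d.2 `<=` envelope C k ->
    exists2 j, (1 <= j <= k)%N & C j = d by apply.
elim=> [|k IH] kl.
  by rewrite envelope0 => /(_ d.1) []; apply/zitvE; lia.
have [dk _|dk] := pselect (zitv d.1 d.2 `<=` envelope C k).
  by have [|j jk Cj] := IH _ dk; [lia|exists j => //; lia].
have [|u [v [uv envk Ck]]] := @chain_step k.+1; first lia.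
rewrite envk => /(subset_zitv _ _ d12) [ud dv].
case: Ck => -[] /= [].
- move=> c1 c2 ic cmax envk'; rewrite envk' in dk.
  have d1 : d.1 = u.
    have [//|ne] := eqVneq d.1 u; case: dk; apply/subset_zitv => //; lia.
  exists k.+1; first lia.
  rewrite [LHS]surjective_pairing [RHS]surjective_pairing c1 d1; congr pair.
  have [c2d|dc2|//] := ltgtP (C k.+1).2 d.2.
    by case: (cmax d.2); [lia|rewrite -id d1].
  have [||j jk wj] := @chain_endpoint k (C k.+1).2; first lia.
    by rewrite envk'; apply/zitvE; lia.
  have [|cj12 cjS icj] := @chain_ibox j; first lia.
  have [uj jv] : u + 1 <= (C j).1 /\ (C j).2 <= v.
    by apply/subset_zitv => //; rewrite -envk'; apply: sub_envelope.
  have Sw : S (C k.+1).2 by case: wj => ->; apply/cjS/zitvE; lia.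
  have ij : i (C j).1 = i u by case: wj ic => ->; rewrite ?icj.
  have [|[_ /(_ (C k.+1).2)]|[/(_ d.1) + _]] := proj1 (commute_boxesE d12 cj12) (dC j _).
  + by lia.
  + by rewrite -id d1 => /(_ Sw dc2 ic); lia.
  + by move=> /(_ Sd1); rewrite d1 ij => /(_ _ erefl); lia.
- move=> c2 c1 ic cmin envk'; rewrite envk' in dk.
  have d2 : d.2 = v.
    have [//|ne] := eqVneq d.2 v; case: dk; apply/subset_zitv => //; lia.
  exists k.+1; first lia.
  rewrite [LHS]surjective_pairing [RHS]surjective_pairing c2 d2; congr pair.
  have [c1d|dc1|//] := ltgtP (C k.+1).1 d.1; last first.
    by case: (cmin d.1); [lia|rewrite id d2].
  have [||j jk wj] := @chain_endpoint k (C k.+1).1; first lia.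
    by rewrite envk'; apply/zitvE; lia.
  have [|cj12 cjS icj] := @chain_ibox j; first lia.
  have [uj jv] : u <= (C j).1 /\ (C j).2 <= v - 1.
    by apply/subset_zitv => //; rewrite -envk'; apply: sub_envelope.
  have Sw : S (C k.+1).1 by case: wj => ->; apply/cjS/zitvE; lia.
  have ij : i (C j).2 = i v by case: wj ic => ->; rewrite -?icj.
  have [|[/(_ (C k.+1).1) + _]|[_ /(_ d.2)]] := proj1 (commute_boxesE d12 cj12) (dC j _).
  + by lia.
  + by rewrite id d2 => /(_ Sw c1d ic); lia.
  + by move=> /(_ Sd2); rewrite d2 ij => /(_ _ erefl); lia.
Qed.

Lemma chain_pairwise_commute j k : (1 <= j <= l)%N -> (1 <= k <= l)%N ->
  commute_boxes S i (C j) (C k).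
Proof.
wlog jk : j k / (j <= k)%N.
  by move=> W jl kl; case/orP: (leq_total j k) => [jk|kj]; [|apply: commute_boxes_sym]; exact: W.
move=> jl kl; apply: commute_boxes_sym.
have [u [v [envk _ uvS ck]]] := chain_itv kl.
have [c12 _ _] := chain_ibox jl.
have [uj jv] : u <= (C j).1 /\ (C j).2 <= v.
  by apply/subset_zitv => //; rewrite -envk; apply: sub_envelope; lia.
by case: ck => /[dup] ck [? ? ? ?]; [apply: (left_box_commute ck)|apply: (right_box_commute ck)].
Qed.

(** The criterion mentions [F] but not the chain, which is what makes the added
end the same for all chains of boxes of [F].  A shorter box [[x, y']] of [F]
must occur in the chain, and it can only come before [[x, y]]; so [x] is then
no longer new.  Without such a box, no earlier step can have added [x]. *)
Lemma chain_new_endpoint (F : set (int * int)) x y k :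
  (forall c d, F c -> F d -> commute_boxes S i c d) ->
  (forall c, F c -> ibox S i c /\ zitv c.1 c.2 `<=` envelope C l) ->
  (forall j, (1 <= j <= l)%N -> F (C j)) ->
  (1 <= k <= l)%N -> C k = (x, y) ->
  envelope C k `\` envelope C k.-1 =
    [set if `[< exists2 y', y' < y & F (x, y') >] then y else x].
Proof.
move=> Fcomm Fbox CF kl Ck.
have [/= xy _ ixy] : ibox S i (x, y) by rewrite -Ck; apply: chain_ibox.
have [u [v [uv envk]]] := chain_step kl.
rewrite Ck /left_box /right_box /= => -[[[xu yuv _ _] envk']|[[yv xuv ix xmin] envk']].
  rewrite envk envk' (zitvD_first uv) -xu; case: ifPn => [/asboolP [y' y'y Fxy']|//].
  have [[/= xy' xy'S ixy'] xy'l] := Fbox _ Fxy'.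
  have [j jl Cj] : exists2 j, (1 <= j <= l)%N & C j = (x, y').
    by apply: chain_complete => // j jl; apply: Fcomm => //; apply: CF.
  have Cjj : zitv x y' `<=` envelope C j.
    by have := @sub_envelope C j j; rewrite Cj; apply; lia.
  have [jk|kj|jk] := ltngtP j k.
  - have /(subset_trans Cjj) : envelope C j `<=` envelope C k.-1.
      by apply: envelope_mono; lia.
    by rewrite envk' => /subset_zitv; lia.
  - have /= := chain_new_point jl; rewrite Cj /=; case.
    have xy'k : zitv x y' `<=` envelope C k by rewrite envk; apply/subset_zitv => //; lia.
    by apply: subset_trans xy'k _; apply: envelope_mono; lia.
  - by move: Cj; rewrite jk Ck => -[]; lia.
rewrite envk envk' (zitvD_last uv) -yv; case: ifPn => [//|/asboolP noF]; congr set1.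
apply: contrapT => yx.
have [||j jk xj] := @chain_endpoint k.-1 x; [lia|by rewrite envk'; apply/zitvE; lia|].
have jl : (1 <= j <= l)%N by lia.
have [cj12 _ icj] := chain_ibox jl.
have [uj jv] : u <= (C j).1 /\ (C j).2 <= v - 1.
  by apply/subset_zitv => //; rewrite -envk'; apply: sub_envelope.
have xj1 : x = (C j).1.
  case: xj => // xj; apply: contrapT => xj1.
  by case: (xmin (C j).1); [lia|rewrite icj -xj ix].
apply: noF; exists (C j).2; first lia.
by rewrite xj1 -surjective_pairing; apply: CF.
Qed.

End Chain.

(** * Chains through commuting families *)

Lemma left_box_unique u v c d : left_box u v c -> left_box u v d -> c = d.
Proof.
move=> [c1 c2 ic cmax] [d1 d2 id dmax].
rewrite [c]surjective_pairing [d]surjective_pairing c1 d1; congr pair.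
have [cd|dc|//] := ltgtP c.2 d.2; first by case: (cmax d.2); [lia|].
by case: (dmax c.2); [lia|].
Qed.

Lemma right_box_unique u v c d : right_box u v c -> right_box u v d -> c = d.
Proof.
move=> [c2 c1 ic cmin] [d2 d1 id dmin].
rewrite [c]surjective_pairing [d]surjective_pairing c2 d2; congr pair.
have [cd|dc|//] := ltgtP c.1 d.1; first by case: (dmin c.1); [lia|].
by case: (cmin d.1); [lia|].
Qed.

Definition append_box n C c := fun k => if (k <= n)%N then C k else c.

Lemma extend_chain n u v c C : ((1 <= n)%N -> admissible_chain S i n C) ->
  v = u + n%:Z -> zitv u v `<=` S -> left_box u v c \/ right_box u v c ->
  envelope C n `|` zitv c.1 c.2 = zitv u v ->
  admissible_chain S i n.+1 (append_box n C c) /\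
  envelope (append_box n C c) n.+1 = zitv u v.
Proof.
move=> chainC vE uvS cuv envc; set D := append_box n C c.
have envD k : (k <= n)%N -> envelope D k = envelope C k.
  by move=> kn; apply: eq_envelope => j jk; rewrite /D /append_box ifT //; lia.
have Dn : D n.+1 = c by rewrite /D /append_box ltnn.
have envDn : envelope D n.+1 = zitv u v by rewrite envelopeS envD // Dn.
split=> //; split=> // k kn; have [kn'|nk] := leqP k n.
  rewrite envD // /D /append_box kn'; have [|_] := chainC; first lia.
  by apply; lia.
have -> : k = n.+1 by lia.
have [c12 cu cv ic] : [/\ c.1 <= c.2, u <= c.1, c.2 <= v & i c.1 = i c.2].
  by case: cuv => -[-> ? -> _]; split=> //; lia.
rewrite envDn Dn; split.
  by split=> //; apply: subset_trans uvS; apply/subset_zitv.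
exists u, v; split=> //; first by apply: card_zitv; lia.
by case: cuv => ?; [left; apply/itv_lboxE|right; apply/itv_rboxE] => //; lia.
Qed.

(** Starting from the empty chain ([n = 0]) makes one-element intervals an
ordinary step. *)
Lemma commuting_family_chain (n : nat) a b (F : set (int * int)) :
  b = a + n%:Z - 1 -> zitv a b `<=` S -> commuting_family S i a b F ->
  exists C, [/\ (1 <= n)%N -> admissible_chain S i n C,
    envelope C n = zitv a b &
    forall d, F d -> exists2 k, (1 <= k <= n)%N & C k = d].
Proof.
elim: n a b F => [|n IH] a b F bE abS [Fbox Fab Fcomm].
  exists (fun=> (0, 0)); split=> //; first by rewrite envelope0 zitv0 //; lia.
  move=> d Fd; have [d12 _ _] := Fbox d Fd.
  by have /subset_zitv := Fab d Fd; lia.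
have ab : a <= b by lia.
have sub_ab u v : a <= u -> v <= b -> zitv u v `<=` zitv a b.
  by move=> au vb t /zitvE tuv; apply/zitvE; lia.
have Fin d : F d -> [/\ d.1 <= d.2, a <= d.1, d.2 <= b & i d.1 = i d.2].
  by move=> Fd; have [d12 _ ?] := Fbox d Fd; have /subset_zitv [] := Fab d Fd.
(* If some box c of F starts at a and stops short of [a, b}, it forces every
   box of F that ends at b to be {a, b]; otherwise only [a, b} starts at a. *)
have [[c Fc [ca [t tb it]]]|noc] := pselect (exists2 c, F c &
    c.1 = a /\ exists2 t, c.2 < t <= b & i t = i a).
- have Fright d : F d -> d.2 = b -> right_box a b d.
    move=> Fd db; have [d12 ad _ id] := Fin d Fd; have [c12 _ _ ic] := Fin c Fc.
    split=> //; [lia|by rewrite id db|move=> s sd is_].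
    have St : S t by apply/abS/zitvE; lia.
    have Ss : S s by apply/abS/zitvE; lia.
    have [[_ /(_ t St)]|[/(_ s Ss)]] := proj1 (commute_boxesE c12 d12) (Fcomm _ _ Fc Fd).
      by rewrite -ic ca => /(_ _ it); lia.
    by rewrite id db => /(_ _ is_); lia.
  have [|||C [chainC envC FC]] := IH a (b - 1) [set d | F d /\ d.2 < b]; first lia.
    - by apply: subset_trans abS; apply: sub_ab; lia.
    - split=> [d [Fd db]|d [Fd db]|d e [Fd _] [Fe _]]; [exact: Fbox| |exact: Fcomm].
      by have [? ? ? ?] := Fin d Fd; apply/subset_zitv => //; lia.
  have [p [_ pb]] := color_ge_min ab abS.
  have [/= _ ap _ _] := pb.
  have [||||chainD envD] := @extend_chain n a b (p, b) C chainC; [lia|done|by right| |].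
    by rewrite envC; apply/seteqP; split=> [s [|] /zitvE /= ?|s /zitvE ?];
      rewrite /setU /= !zitvE; lia.
  exists (append_box n C (p, b)); split=> // d Fd.
  have [? ? ? ?] := Fin d Fd.
  have [db|db] := eqVneq d.2 b.
    exists n.+1; first lia.
    by rewrite /append_box ltnn; apply: right_box_unique pb _; apply: Fright.
  have [|k kn Ck] := FC d; first by split=> //; lia.
  by exists k; [lia|rewrite /append_box ifT //; lia].
- have Fleft d : F d -> d.1 = a -> left_box a b d.
    move=> Fd da; have [d12 ad db id] := Fin d Fd.
    split=> //; [lia|by rewrite -id da|move=> s sd is_].
    by apply: noc; exists d => //; split=> //; exists s.
  have [|||C [chainC envC FC]] := IH (a + 1) b [set d | F d /\ a < d.1]; first lia.
    - by apply: subset_trans abS; apply: sub_ab; lia.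
    - split=> [d [Fd ad]|d [Fd ad]|d e [Fd _] [Fe _]]; [exact: Fbox| |exact: Fcomm].
      by have [? ? ? ?] := Fin d Fd; apply/subset_zitv => //; lia.
  have [q [_ aq]] := color_le_max ab abS.
  have [/= _ qb _ _] := aq.
  have [||||chainD envD] := @extend_chain n a b (a, q) C chainC; [lia|done|by left| |].
    by rewrite envC; apply/seteqP; split=> [s [|] /zitvE /= ?|s /zitvE ?];
      rewrite /setU /= !zitvE; lia.
  exists (append_box n C (a, q)); split=> // d Fd.
  have [? ? ? ?] := Fin d Fd.
  have [da|da] := eqVneq d.1 a.
    exists n.+1; first lia.
    by rewrite /append_box ltnn; apply: left_box_unique aq _; apply: Fleft.
  have [|k kn Ck] := FC d; first by split=> //; lia.
  by exists k; [lia|rewrite /append_box ifT //; lia].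
Qed.

(** A chain through all of [F] is itself a commuting family, so it cannot be
larger than a maximal [F]. *)
Lemma maximal_family_chain a b (F : set (int * int)) :
  a <= b -> zitv a b `<=` S -> maximal_commuting_family S i a b F ->
  exists l C, [/\ admissible_chain S i l C, envelope C l = zitv a b,
    forall k, (1 <= k <= l)%N -> F (C k) &
    forall d, F d -> exists2 k, (1 <= k <= l)%N & C k = d].
Proof.
move=> ab abS [Fcomm Fmax]; pose n := absz (b - a + 1).
have [|C [chainC envC FC]] := @commuting_family_chain n a b F _ abS Fcomm.
  by rewrite /n; lia.
have {}chainC : admissible_chain S i n C by apply: chainC; rewrite /n; lia.
exists n, C; split=> // k kn.
rewrite -(Fmax [set C j | j in [set j | (1 <= j <= n)%N]]).
- by exists k.
- split=> [_ [j jn <-]|_ [j jn <-]|_ _ [j jn <-] [m mn <-]].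
  + exact: chain_ibox chainC _ jn.
  + by rewrite -envC; apply: sub_envelope.
  + exact: chain_pairwise_commute chainC _ _ jn mn.
- by move=> d /FC [j jn <-]; exists j.
Qed.

End Chains.

(** * The added end is determined by the family *)

Theorem proposition2p12 (I : Type) (S : set int) (i : int -> I) (a b : int)
    (F : set (int * int)) :
  is_interval S ->
  a <= b ->
  zitv a b `<=` S ->
  maximal_commuting_family S i a b F ->
  forall x y : int, F (x, y) ->
  exists! z : int,
    [set x; y] z /\
    forall (l : nat) (c : nat -> int * int),
      admissible_chain S i l c ->
      envelope c l = zitv a b ->
      (forall k : nat, (1 <= k <= l)%N -> F (c k)) ->
      forall k : nat, (1 <= k <= l)%N -> (x, y) = c k ->
        [set z] = envelope c k `\` envelope c k.-1.
Proof.
move=> _ ab abS Fmax x y Fxy; have [[Fbox Fab Fcomm] _] := Fmax.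
have [l [C [chainC envC CF FC]]] := maximal_family_chain ab abS Fmax.
have [k kl Ck] := FC _ Fxy.
exists (if `[< exists2 y', y' < y & F (x, y') >] then y else x); split.
  split=> [|l' c chainc envc cF k' kl' ck']; first by case: ifP; [right|left].
  symmetry; apply: (chain_new_endpoint chainc) => // d Fd.
  by split; [apply: Fbox|rewrite envc; apply: Fab].
move=> z [_ /(_ _ _ chainC envC CF k kl (esym Ck))].
rewrite (chain_new_endpoint chainC Fcomm _ CF kl Ck) => [zE|d Fd]; last first.
  by split; [apply: Fbox|rewrite envC; apply: Fab].
by have : [set z] z by []; rewrite zE.
Qed.
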